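(* Let $C$ be an archimedean component in a commutative monoid $M$, and set $\mathrm{sr}_M(C) := \{ \mathrm{sr}_M(c) \mid c \in C \}$. (1) The set $\mathrm{sr}_M(C)$ equals $\mathbb{Z}_{>0}$ or $\mathbb{Z}_{\ge 2}$ or $\{\infty\}$ or a finite subset of $\mathbb{Z}_{>0}$. (2) If $M$ is conical, then $\mathrm{sr}_M(C)$ equals $\{1\}$ or $\mathbb{Z}_{\ge 2}$ or $\{\infty\}$ or a finite subset of $\mathbb{Z}_{\ge 2}$.
   Context: All monoids are commutative and written additively. For a monoid $M$ and $a \in M$, the stable rank $\mathrm{sr}_M(a) \in \mathbb{Z}_{>0} \cup \{\infty\}$ is the least positive integer $n$ such that: for all $x,y \in M$ with $na + x = a + y$ there exists $e \in M$ with $na = a + e$ and $e + x = y$. If no such $n$ exists, $\mathrm{sr}_M(a) = \infty$. The algebraic order on $M$: $x \le y$ iff $x + z = y$ for some $z \in M$. Elements $x,y \in M$ are asymptotic, $x \asymp y$, if there exist $m,n \in \mathbb{Z}_{>0}$ with $x \le my$ and $y \le nx$. This is an equivalence relation, and its equivalence classes are the archimedean components of $M$. $M$ is conical if $x + y = 0$ implies $x = y = 0$ for any $x,y \in M$. *)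

(* Defs.v *)
From HB Require Import structures.
From mathcomp Require Import all_boot all_order all_algebra.
From mathcomp Require Import boolp classical_sets functions cardinality.

Set Implicit Arguments.
Unset Strict Implicit.
Unset Printing Implicit Defensive.

Import GRing.Theory.
Local Open Scope ring_scope.
Local Open Scope classical_set_scope.

Definition alg_le (M : nmodType) (x y : M) : Prop := exists z : M, x + z = y.

Definition asymptotic (M : nmodType) (x y : M) : Prop :=
  exists m n : nat,
    [/\ (0 < m)%N, (0 < n)%N, alg_le x (y *+ m) & alg_le y (x *+ n)].

Definition archimedean_component (M : nmodType) (C : set M) : Prop :=
  exists a : M, C = [set x | asymptotic a x].

Definition conical (M : nmodType) : Prop :=
  forall x y : M, x + y = 0 -> x = 0 /\ y = 0.

Definition sr_condition (M : nmodType) (a : M) (n : nat) : Prop :=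
  forall x y : M, a *+ n + x = a + y ->
    exists e : M, a *+ n = a + e /\ e + x = y.

(* Stable ranks live in [option nat], with [None] standing for infinity;
   [Some 0] is never a value of [sr]. *)
Definition sr (M : nmodType) (a : M) : option nat :=
  if pselect (exists n : nat, (0 < n)%N && `[< sr_condition a n >]) is left exP
  then Some (ex_minn exP) else None.

Definition sr_set (M : nmodType) (C : set M) : set (option nat) :=
  [set sr c | c in C].

Definition nat_ge (k : nat) : set (option nat) :=
  [set Some n | n in [set n : nat | (k <= n)%N]].

Lemma sr_SomeP (M : nmodType) (a : M) (n : nat) :
  sr a = Some n <->
  [/\ (0 < n)%N, sr_condition a n &
      forall m : nat, (0 < m)%N -> sr_condition a m -> (n <= m)%N].
Proof.
rewrite /sr; case: pselect => [exP|nexP]; last first.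
  by split=> // -[n0 an _]; case: nexP; exists n; rewrite n0; apply/asboolP.
case: ex_minnP => p /andP[p0 /asboolP ap] pmin; split=> [[<-]|[n0 an nmin]].
  by split=> // m m0 am; apply: pmin; rewrite m0; apply/asboolP.
congr Some; apply/eqP; rewrite eqn_leq nmin// andbT.
by apply: pmin; rewrite n0; apply/asboolP.
Qed.

Lemma sr_NoneP (M : nmodType) (a : M) :
  sr a = None <-> forall n : nat, (0 < n)%N -> ~ sr_condition a n.
Proof.
rewrite /sr; case: pselect => [exP|nexP]; split=> //.
  by move=> nsr; have [n /andP[n0 /asboolP an]] := exP; case: (nsr n n0).
by move=> _ n n0 an; apply: nexP; exists n; rewrite n0; apply/asboolP.
Qed.

(* Main.v *)
Require Import Defs.
From HB Require Import structures.
From mathcomp Require Import all_boot all_order all_algebra.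
From mathcomp Require Import boolp classical_sets functions cardinality.
From mathcomp Require Import zify ssrAC.

(* Write T(k, p) for: (k + p)a + x = ka + y implies that y = e + x for some e
   with (k + p)a = ka + e. Then sr(ka) <= m + 1 iff T(k, mk). The property T is
   monotone in p and in k >= 1, and conversely T(k + 1, p) implies T(k, p + 1).
   Hence, if sr(a) is large compared with t and k is least with T(k, tk), then
   k > t and T(k, (t - 1)k) fails, so that sr(ka) = t + 1: an unbounded
   component takes all values >= 2. Finiteness of the stable rank propagates in
   a component because b <= a <= lb and sr(a) <= n force sr(b) <= nl, where a may
   be replaced by a multiple since sr(ka) <= sr(a). If M is conical,
   then sr(a) = 1 means that a is cancellable, which is inherited by every
   element below a multiple of a. *)

Set Implicit Arguments.
Unset Strict Implicit.
Unset Printing Implicit Defensive.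

Import GRing.Theory.
Local Open Scope ring_scope.
Local Open Scope classical_set_scope.

(** This is T(k, p) for [a]. It holds trivially at [k = 0], so monotonicity in [k] can only start at
    1. *)
Definition multiple_cancels (M : nmodType) (a : M) (k p : nat) : Prop :=
  forall x y : M, a *+ (k + p) + x = a *+ k + y ->
    exists e : M, a *+ (k + p) = a *+ k + e /\ e + x = y.

(** * Monotonicity and descent for T(k, p) *)

Section StableRank.

Variable M : nmodType.
Implicit Types (a b c x y z e : M) (k m n p t : nat).

Lemma sr_condition_mulrn a k m :
  sr_condition (a *+ k) m.+1 <-> multiple_cancels a k (m * k).
Proof.
by rewrite /sr_condition /multiple_cancels -mulrnA mulnS (mulnC k m).
Qed.

Lemma sr_condition1 a n : sr_condition a n.+1 <-> multiple_cancels a 1 n.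
Proof. by have := sr_condition_mulrn a 1 n; rewrite mulr1n muln1. Qed.

Lemma multiple_cancels_leq_gap a k p q :
  (p <= q)%N -> multiple_cancels a k p -> multiple_cancels a k q.
Proof.
move=> /subnKC <- ap x y; rewrite addnA mulrnDr -addrA => /ap[e [ae <-]].
by exists (e + a *+ (q - p)); rewrite ae -!addrA.
Qed.

(** T(k, p) is applied twice: first with a copy of [a] moved into [x] and [y], which yields
    [e + (a + x) = a + y]; then to [x] and [y] themselves, a copy of [a] for that identity being
    supplied by ka since [0 < k]. *)
Lemma multiple_cancelsS a k p :
  (0 < k)%N -> multiple_cancels a k p -> multiple_cancels a k.+1 p.
Proof.
case: k => // k _ ap x y.
rewrite addSn (mulrSr a (k.+1 + p)) (mulrSr a k.+1) -!addrA => /ap[e [ae exy]].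
have /ap[e' [ae' <-]] : a *+ (k.+1 + p) + x = a *+ k.+1 + y.
  by rewrite ae (mulrSr a k) -!addrA -exy [a + (e + x)]addrCA.
by exists e'; split=> //; rewrite ae' addrAC.
Qed.

Lemma multiple_cancels_leq a k k' p : (0 < k <= k')%N ->
  multiple_cancels a k p -> multiple_cancels a k' p.
Proof.
move=> /andP[k0 /subnKC <-] ap; elim: (k' - k)%N => [|d IHd]; rewrite ?addn0//.
by rewrite addnS; apply: multiple_cancelsS IHd; rewrite ltn_addr.
Qed.

(** Adding [a] to both sides reaches level k + 1; the witness then absorbs the extra copy. *)
Lemma multiple_cancels_pred a k p :
  multiple_cancels a k.+1 p -> multiple_cancels a k p.+1.
Proof.
move=> ap x y axy.
have /ap[e [ae <-]] : a *+ (k.+1 + p) + (a + x) = a *+ k.+1 + y.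
  by rewrite addrCA addSnnS axy mulrS addrA.
by exists (e + a); rewrite -addSnnS ae mulrSr -!addrA (addrC a e).
Qed.

Lemma multiple_cancels1 a k p :
  multiple_cancels a k.+1 p -> multiple_cancels a 1 (p + k).
Proof.
elim: k p => [|k IHk] p; first by rewrite addn0.
by move=> /multiple_cancels_pred/IHk; rewrite addSnnS.
Qed.

Lemma sr_condition_leq a m n :
  (m <= n)%N -> sr_condition a m.+1 -> sr_condition a n.+1.
Proof.
by move=> mn /sr_condition1 am; apply/sr_condition1/(multiple_cancels_leq_gap mn).
Qed.

Lemma sr_eqS a n : sr_condition a n.+2 -> ~ sr_condition a n.+1 ->
  sr a = Some n.+2.
Proof.
move=> an2 an1; apply/sr_SomeP; split=> // -[//|m] _ am.
by rewrite ltnS ltnNge; apply/negP => mn; apply/an1/(sr_condition_leq mn).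
Qed.

Lemma sr_mulrn_surj a n t : (t.+1 * t.+2 < n)%N -> sr a = Some n ->
  exists2 k, (0 < k)%N & sr (a *+ k) = Some t.+2.
Proof.
move=> tn /sr_SomeP[n0 an nmin].
have an1 : multiple_cancels a 1 n.
  by apply/sr_condition1; case: n n0 an {nmin tn} => // n _; apply: sr_condition_leq.
(* T(t + 1, (t + 1)^2) would descend to T(1, (t + 1)^2 + t), that is sr(a) <= (t + 1)(t + 2); hence
   the bound assumed on [n]. *)
have Nt : ~ multiple_cancels a t.+1 (t.+1 * t.+1).
  move=> /multiple_cancels1/sr_condition1 /(nmin _ (ltn0Sn _)).
  apply/negP; rewrite -ltnNge; apply: leq_trans tn; lia.
(* For k > 0, [P k] means sr(ka) <= t + 2; the overview's t is [t.+1] here. *)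
pose P k := (0 < k)%N && `[< multiple_cancels a k (t.+1 * k) >].
have exP : exists k, P k.
  exists n; rewrite /P n0; apply/asboolP.
  apply: (@multiple_cancels_leq_gap _ _ n); first by rewrite mulSn leq_addr.
  exact: multiple_cancels_leq an1.
case: (ex_minnP exP) => k /andP[k0 /asboolP ak] kmin; exists k => //.
have tk : (t.+1 < k)%N.
  rewrite ltnNge; apply/negP => kt; apply: Nt.
  apply: (@multiple_cancels_leq_gap _ _ (t.+1 * k)); first by rewrite leq_mul2l.
  by apply: multiple_cancels_leq ak; rewrite k0.
apply: sr_eqS; first exact/sr_condition_mulrn.
move=> /sr_condition_mulrn; case: k k0 ak kmin tk => // k _ _ kmin tk.
(* The least index is now k + 1. T(k + 1, t(k + 1)) descends to T(k, t(k + 1) + 1), which gives T(k,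
   (t + 1)k) because t < k. *)
move=> /multiple_cancels_pred ak; suff /kmin : P k by rewrite ltnn.
rewrite /P (leq_trans (ltn0Sn t) tk); apply/asboolP.
by apply: multiple_cancels_leq_gap ak; rewrite mulSn mulnS; lia.
Qed.

(** * Finite stable rank within a component *)

Lemma sr_condition_mul a k n :
  (0 < k)%N -> sr_condition a n.+1 -> sr_condition (a *+ k) n.+1.
Proof.
move=> k0 /sr_condition1 an; apply/sr_condition_mulrn.
apply: (multiple_cancels_leq_gap (leq_pmulr n k0)).
exact: multiple_cancels_leq an.
Qed.

(** With b + c = a and a + d = (l + 1)b, adding c turns an equation for b into one for a. If e is
    the witness for a, then e + lb + nd is one for b. *)
Lemma sr_condition_alg_le a b l n : alg_le b a -> alg_le a (b *+ l.+1) ->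
  sr_condition a n.+1 -> sr_condition b (n.+1 * l.+1).
Proof.
move=> [c bc] [d ad] an x y bxy.
have bE : b *+ (n.+1 * l.+1) = b + (b *+ l + (a *+ n + d *+ n)).
  by rewrite mulSn mulrnDr mulrS -addrA (mulnC n) mulrnA -ad mulrnDl.
have /an[e [ae <-]] : a *+ n.+1 + (b *+ l + d *+ n + x) = a + y.
  rewrite -{2}bc addrAC -bxy bE mulrS -{1}bc.
  by rewrite (AC ((2*1)*(2*1)) ((1*(4*(3*5)))*6*2)).
exists (e + (b *+ l + d *+ n)); split; last by rewrite -!addrA.
rewrite addrCA [b + _]addrA -mulrS -ad.
by rewrite mulnC mulrnA -ad mulrnDl ae (mulrS d) -!addrA [LHS]addrCA.
Qed.

Lemma asymptotic_sym x y : asymptotic x y -> asymptotic y x.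
Proof. by move=> [m [n [m0 n0 xy yx]]]; exists n, m. Qed.

Lemma alg_le_trans y x z : alg_le x y -> alg_le y z -> alg_le x z.
Proof. by move=> [u <-] [v <-]; exists (u + v); rewrite addrA. Qed.

Lemma alg_le_mulrn x y n : alg_le x y -> alg_le (x *+ n) (y *+ n).
Proof. by move=> [u <-]; exists (u *+ n); rewrite mulrnDl. Qed.

Lemma asymptotic_trans y x z :
  asymptotic x y -> asymptotic y z -> asymptotic x z.
Proof.
move=> [m [n [m0 n0 xy yx]]] [p [q [p0 q0 yz zy]]].
exists (p * m)%N, (n * q)%N; split; rewrite ?muln_gt0 ?m0 ?n0 ?p0 ?q0 ?mulrnA//.
  exact/(alg_le_trans xy)/alg_le_mulrn.
exact/(alg_le_trans zy)/alg_le_mulrn.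
Qed.

Lemma asymptotic_mulrn a k : (0 < k)%N -> asymptotic a (a *+ k).
Proof.
case: k => // k _; exists 1%N, k.+1; split=> //; last by exists 0; rewrite addr0.
by exists (a *+ k); rewrite mulr1n mulrS.
Qed.

Lemma sr_finite_asymptotic a b :
  asymptotic a b -> sr a <> None -> sr b <> None.
Proof.
move=> [m [n [m0 n0 ab ba]]].
case aN : (sr a) => [[|N]|] // _; first by case/sr_SomeP: aN.
have /sr_SomeP[_ /(sr_condition_mul n0) anN _] := aN.
(* The comparison is between b and na, where b <= na <= (mn)b, so l + 1 = mn. *)
move=> /sr_NoneP/(_ (N.+1 * (m * n).-1.+1)%N) []; first by rewrite muln_gt0.
apply: sr_condition_alg_le anN => //.
by rewrite prednK ?muln_gt0 ?m0// mulrnA; apply: alg_le_mulrn.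
Qed.

Lemma conical_sr1P a : conical M ->
  sr a = Some 1%N <-> injective (+%R a).
Proof.
move=> coM; split=> [/sr_SomeP[_ a1 _] x y axy|ainj].
  have [|e [ae <-]] := a1 x y; first by rewrite mulr1n.
  (* Since a + e = a + 0, a second use of the condition gives f + e = 0, and conicality forces e =
     0. *)
  have [|f [_ /coM[_ ->]]] := a1 e 0; last by rewrite add0r.
  by rewrite mulr1n addr0.
apply/sr_SomeP; split=> // x y; rewrite mulr1n => /ainj <-.
by exists 0; rewrite addr0 add0r.
Qed.

Lemma addr_inj_mulrn a n : injective (+%R a) -> injective (+%R (a *+ n)).
Proof.
move=> ainj; elim: n => [|n IHn] x y; first by rewrite !add0r.
by rewrite mulrS -!addrA => /ainj/IHn.
Qed.

Lemma addr_inj_alg_le a b : alg_le b a -> injective (+%R a) ->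
  injective (+%R b).
Proof. by move=> [c <-] ainj x y bxy; apply: ainj; rewrite addrAC bxy addrAC. Qed.

Lemma conical_sr1_asymptotic a b : conical M -> asymptotic a b ->
  sr a = Some 1%N -> sr b = Some 1%N.
Proof.
move=> coM [m [n [_ _ _ ba]]] /(conical_sr1P _ coM) ainj.
exact/(conical_sr1P _ coM)/(addr_inj_alg_le ba)/addr_inj_mulrn.
Qed.

End StableRank.

Lemma finite_set_bounded_Some (S : set (option nat)) (N : nat) :
  (forall o, S o -> exists2 n, o = Some n & (n <= N)%N) -> finite_set S.
Proof.
move=> SN; apply: (@sub_finite_set _ _ [set Some n | n in `I_N.+1]).
  by move=> o /SN[n -> nN]; exists n.
exact/finite_image/finite_II.
Qed.

(** * The set of stable ranks of a component *)

Section Component.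

Variables (M : nmodType) (C : set M).
Hypothesis hC : archimedean_component C.

Lemma component_asymptotic a b : C a -> (C b <-> asymptotic a b).
Proof.
case: hC => z -> /= za; split=> [zb|ab].
  exact: asymptotic_trans (asymptotic_sym za) zb.
exact: asymptotic_trans za ab.
Qed.

Lemma component_neq0 : exists a, C a.
Proof.
case: hC => z ->; exists z; rewrite /= -{2}[z]mulr1n.
exact: asymptotic_mulrn.
Qed.

Lemma sr_set_finite_ranks : sr_set C <> [set None] -> sr_set C `<=` nat_ge 1.
Proof.
move=> CN _ [b Cb <-].
have [a Ca aN] : exists2 a, C a & sr a <> None.
  apply: contrapT => nex; apply: CN; apply/seteqP; split=> [_ [a Ca <-]|_ ->] /=.
    by apply: contrapT => aN; apply: nex; exists a.
  have [a Ca] := component_neq0; exists a => //.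
  by apply: contrapT => aN; apply: nex; exists a.
have := sr_finite_asymptotic ((component_asymptotic b Ca).1 Cb) aN.
case bn : (sr b) => [n|]// _; exists n => //=.
by have /sr_SomeP[] := bn.
Qed.

(** An infinite set of finite ranks is unbounded, so for each t some rank exceeds (t + 1)(t + 2). *)
Lemma sr_set_infinite : sr_set C `<=` nat_ge 1 -> ~ finite_set (sr_set C) ->
  nat_ge 2 `<=` sr_set C.
Proof.
move=> C1 Cinf _ [[|[|t]]// _ <-].
have [a Ca [n an tn]] :
    exists2 a, C a & exists2 n, sr a = Some n & (t.+1 * t.+2 < n)%N.
  apply: contrapT => nex; apply: Cinf.
  apply: (@finite_set_bounded_Some _ (t.+1 * t.+2)) => _ [a Ca <-].
  have [n _ /esym an] := C1 _ (imageP (@sr M) Ca); exists n => //.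
  by rewrite leqNgt; apply/negP => tn; apply: nex; exists a => //; exists n.
have [k k0 ak] := sr_mulrn_surj tn an; exists (a *+ k) => //.
exact/(component_asymptotic _ Ca)/asymptotic_mulrn.
Qed.

Lemma sr_set_conical1 : conical M -> sr_set C (Some 1%N) ->
  sr_set C = [set Some 1%N].
Proof.
move=> coM [a Ca a1]; apply/seteqP; split=> [_ [b Cb <-]|_ ->] /=.
  exact: conical_sr1_asymptotic coM ((component_asymptotic b Ca).1 Cb) a1.
by exists a.
Qed.

End Component.

Lemma nat_ge1_sub_ge2 (S : set (option nat)) :
  S `<=` nat_ge 1 -> ~ S (Some 1%N) -> S `<=` nat_ge 2.
Proof.
move=> S1 N1 o So; have [[|[|n]]// _ on] := S1 o So; last by exists n.+2.
by case: N1; rewrite on.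
Qed.

Theorem theoremC (M : nmodType) (C : set M) (hC : archimedean_component C) :
  [\/ sr_set C = nat_ge 1,
      sr_set C = nat_ge 2,
      sr_set C = [set None]
    | finite_set (sr_set C) /\ sr_set C `<=` nat_ge 1] /\
  (conical M ->
    [\/ sr_set C = [set Some 1%N],
        sr_set C = nat_ge 2,
        sr_set C = [set None]
      | finite_set (sr_set C) /\ sr_set C `<=` nat_ge 2]).
Proof.
have [CN|CN] := pselect (sr_set C = [set None]).
  by split=> [|_]; apply: Or43.
have C1 := sr_set_finite_ranks hC CN.
have [fC|iC] := pselect (finite_set (sr_set C)).
  split=> [|coM]; first exact: Or44.
  have [/(sr_set_conical1 hC coM) ?|n1] := pselect (sr_set C (Some 1%N)).
    exact: Or41.
  by apply: Or44; split=> //; apply: nat_ge1_sub_ge2.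
have C2 := sr_set_infinite hC C1 iC.
(* All values from 2 on are attained; only membership of 1 is left to decide. *)
have [c1|n1] := pselect (sr_set C (Some 1%N)); last first.
  suff -> : sr_set C = nat_ge 2 by split=> [|_]; apply: Or42.
  by apply/seteqP; split=> //; apply: nat_ge1_sub_ge2.
split=> [|coM]; last exact/Or41/sr_set_conical1.
apply/Or41/seteqP; split=> // _ [[|[|n]]// _ <-] //.
by apply: C2; exists n.+2.
Qed.
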